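(* Let $n\geqslant 2$ and let $x_1,\ldots,x_{n-1}$ be nonnegative real numbers. Then, in $\mathbb C[\mathfrak S_n]$, \[ \Bigl(\sum_{i<n}x_i\Bigr)\sum_{i<n}x_i\bigl(1-(i\,n)\bigr)-\sum_{i<j<n}x_ix_j\bigl(1-(i\,j)\bigr)\succeq 0 . \]
   Context: Here $1$ is the identity of $\mathbb C[\mathfrak S_n]$, $(i\,j)$ denotes a transposition, and indices $i,j$ range over $\{1,\ldots,n-1\}$. Let $*$ be the antilinear involution on $\mathbb C[\mathfrak S_n]$ with $\sigma^*=\sigma^{-1}$. For self-adjoint $A\in\mathbb C[\mathfrak S_n]$ (i.e. $A^*=A$), write $A\succeq 0$ if $\rho(A)$ is positive semidefinite in every (finite-dimensional) unitary representation $\rho$ of $\mathfrak S_n$. *)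

(* Defs.v *)
From HB Require Import structures.
From mathcomp Require Import all_boot all_order all_algebra all_fingroup.
From mathcomp Require Import spectral mxrepresentation.
From mathcomp Require Import reals.
From mathcomp.real_closed Require Export complex.

Set Implicit Arguments.
Unset Strict Implicit.
Unset Printing Implicit Defensive.

Import Order.TTheory GRing.Theory Num.Theory.
Local Open Scope ring_scope.
Local Open Scope sesquilinear_scope.

(* C[G] is the [group_ring C G] of [mxrepresentation]: an element
   \sum_g a_g g is represented by the matrix \sum_g a_g *: regular_repr C G g,
   the unit is 1%:M, and [gring_op rG] is the linear extension of the
   representation rG to C[G]. *)
Section GroupAlgebra.
Variables (C : numClosedFieldType) (gT : finGroupType) (G : {group gT}).

Definition gring_coef (A : 'M[C]_#|G|) (g : gT) : C :=
  gring_row A 0 (gring_index G g).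

Definition gring_star (A : 'M[C]_#|G|) : 'M[C]_#|G| :=
  \sum_(g in G) (gring_coef A g)^* *: regular_repr C G (g^-1)%g.

Definition unitary_repr (d : nat) (rG : mx_representation C G d) : Prop :=
  forall g, g \in G -> rG g \is unitarymx.

(* Row vectors, as matrices of a [mx_representation] act on the right. *)
Definition psdmx (d : nat) (M : 'M[C]_d) : Prop :=
  M \is hermsymmx /\ forall v : 'rV[C]_d, 0 <= (v *m M *m v^t*) 0 0.

Definition gring_psd (A : 'M[C]_#|G|) : Prop :=
  [/\ (A \in group_ring C G)%MS, gring_star A = A &
      forall (d : nat) (rG : mx_representation C G d),
        unitary_repr rG -> psdmx (gring_op rG A)].

End GroupAlgebra.

(* The points 1, ..., n are the elements 0, ..., n-1 of 'I_n, so that the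
   indices 1, ..., n-1 are those of 'I_n.-1, included in 'I_n by [init_pt],
   and the point n is [last_pt]. *)
Definition init_pt (n : nat) (i : 'I_n.-1) : 'I_n := widen_ord (leq_pred n) i.

Lemma last_pt_proof (n : nat) : (1 < n)%N -> (n.-1 < n)%N.
Proof. by case: n. Qed.

Definition last_pt (n : nat) (hn : (1 < n)%N) : 'I_n :=
  Ordinal (last_pt_proof hn).

(* The transposition (i j), as an element of C[S_n]. *)
Definition transp (C : fieldType) (n : nat) (i j : 'I_n) :
    'M[C]_#|[set: 'S_n]%G| :=
  regular_repr C [set: 'S_n]%G (tperm i j).

(* Main.v *)
(* Give the point n the weight x_n := - \sum_(i < n) x_i, so that the weights
   sum to 0 and twice the element is Q := \sum_(i, j <= n) x_i x_j (i j), with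
   (i i) := 1. With D := \sum_i x_i^2, the cancellation \sum_i x_i = 0 gives
       2 D Q = Q^2 - \sum_(J, |J| = 4) 4 x_J M_J,   x_J := \prod_(i in J) x_i,
   where M_J := 2 (1 + sum of the 3 double transpositions of J) - (sum of the
   8 three-cycles of J) satisfies M_J^* M_J = 12 M_J, hence is positive. For J
   containing n, -x_J >= 0, and expanding x_n turns the last sum into positive
   terms plus the sum over J = {i,j,k,l} avoiding n of
       4 x_J (M_ijkn + M_ijln + M_ikln + M_jkln - M_ijkl) = 8 x_J N,
   where N^* N = 12 N. All this is evaluated on the function
   g |-> v rho(g) v^*, which is of positive type. *)
Require Import Defs.
From mathcomp Require Import all_boot all_order all_algebra all_fingroup.
From mathcomp Require Import reals mxrepresentation ring.

Import Order.POrderTheory GRing.Theory Num.Theory.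
Local Open Scope ring_scope.
Local Open Scope complex_scope.

Set Implicit Arguments.
Unset Strict Implicit.
Unset Printing Implicit Defensive.

(** * Integer combinations of words of transpositions *)

(* [(c, [:: (a1, b1); ...; (ar, br)])] stands for c (a1 b1) ... (ar br). *)
Definition comb (T : Type) := seq (int * seq (T * T)).

Definition comb_scale (T : Type) (c : int) (E : comb T) : comb T :=
  [seq (c * e.1, e.2) | e <- E].

(** Represents [E] times its adjoint: transpositions are involutions, so the reversed word denotes
    the inverse permutation. *)
Definition comb_mulstar (T : Type) (E : comb T) : comb T :=
  [seq (a.1 * b.1, a.2 ++ rev b.2) | a <- E, b <- E].

Definition comb_map (T U : Type) (h : T -> U) (E : comb T) : comb U :=
  [seq (e.1, [seq (h t.1, h t.2) | t <- e.2]) | e <- E].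

(** Letters act from left to right, the order in which [permM] composes permutations. *)
Definition word_act (w : seq (nat * nat)) (a : nat) : nat :=
  foldl (fun a t => if a == t.1 then t.2 else if a == t.2 then t.1 else a) a w.

Definition word_table (m : nat) (w : seq (nat * nat)) : seq nat :=
  [seq word_act w a | a <- iota 0 m].

Definition word_in (m : nat) (w : seq (nat * nat)) : bool :=
  all (fun t => (t.1 < m)%N && (t.2 < m)%N) w.

Fixpoint collect (D : seq (int * seq nat)) (c : int) (t : seq nat) :=
  if D is d :: D' then
    if t == d.2 then (c + d.1, t) :: D' else d :: collect D' c t
  else [:: (c, t)].

(* Sufficient for [E] to vanish in the group algebra: words with the same table
   denote the same permutation, and their coefficients sum to 0. *)
Definition balanced (m : nat) (E : comb nat) : bool :=
  all (fun e => word_in m e.2) E &&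
  all (fun d => d.1 == 0)
    (foldr (fun e D => collect D e.1 (word_table m e.2)) [::] E).

(* The sum of [F] over the 24 orderings of its arguments, as the product of
   three sums over coset representatives; [add] is the addition. *)
Definition st2 (T A : Type) (add : A -> A -> A)
    (F : T -> T -> T -> T -> A) i j k l :=
  add (F i j k l) (F j i k l).

Definition st3 (T A : Type) (add : A -> A -> A)
    (F : T -> T -> T -> T -> A) i j k l :=
  add (F i j k l) (add (F i k j l) (F k j i l)).

Definition st4 (T A : Type) (add : A -> A -> A)
    (F : T -> T -> T -> T -> A) i j k l :=
  add (F i j k l) (add (F i j l k) (add (F i l k j) (F l j k i))).

Definition symm4 (T A : Type) (add : A -> A -> A)
    (F : T -> T -> T -> T -> A) :=
  st4 add (st3 add (st2 add F)).

(* The second term is -3 (Q^2), the first one 6 D Q; the others do not depend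
   on [l], so that they vanish once weighted and summed, and are chosen so that
   the symmetrization vanishes when two arguments coincide. *)
Definition defect (T : eqType) (i j k l : T) : comb T :=
  [:: (((k == l) * 6)%:Z, [:: (i, j)]); (-3, [:: (i, j); (k, l)]);
      (4, [:: (i, j); (j, k)]); (- ((i == j) * 8)%:Z, [:: (i, k)]);
      (((i == j) * 2)%:Z, [::]); (-1, [::])].

(* M_ijkl *)
Definition quad (T : eqType) (i j k l : T) : comb T :=
  [:: (2, [::]);
      (2, [:: (i, j); (k, l)]); (2, [:: (i, k); (j, l)]); (2, [:: (i, l); (j, k)]);
      (-1, [:: (i, j); (j, k)]); (-1, [:: (j, k); (i, j)]);
      (-1, [:: (i, j); (j, l)]); (-1, [:: (j, l); (i, j)]);
      (-1, [:: (i, k); (k, l)]); (-1, [:: (k, l); (i, k)]);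
      (-1, [:: (j, k); (k, l)]); (-1, [:: (k, l); (j, k)])].

(* N, with [p] for n *)
Definition quint (T : eqType) (i j k l p : T) : comb T :=
  [:: (3, [::]);
      (-1, [:: (i, j); (k, l)]); (-1, [:: (i, k); (j, l)]);
      (-1, [:: (i, l); (j, k)]);
      (1, [:: (i, p); (j, k)]); (1, [:: (i, p); (j, l)]); (1, [:: (i, p); (k, l)]);
      (1, [:: (j, p); (i, k)]); (1, [:: (j, p); (i, l)]); (1, [:: (j, p); (k, l)]);
      (1, [:: (k, p); (i, j)]); (1, [:: (k, p); (i, l)]); (1, [:: (k, p); (j, l)]);
      (1, [:: (l, p); (i, j)]); (1, [:: (l, p); (i, k)]); (1, [:: (l, p); (j, k)]);
      (-1, [:: (i, p); (p, j)]); (-1, [:: (p, j); (i, p)]);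
      (-1, [:: (i, p); (p, k)]); (-1, [:: (p, k); (i, p)]);
      (-1, [:: (i, p); (p, l)]); (-1, [:: (p, l); (i, p)]);
      (-1, [:: (j, p); (p, k)]); (-1, [:: (p, k); (j, p)]);
      (-1, [:: (j, p); (p, l)]); (-1, [:: (p, l); (j, p)]);
      (-1, [:: (k, p); (p, l)]); (-1, [:: (p, l); (k, p)])].

(** * Values of combinations at functions of positive type *)

Definition wperm (T : finType) (w : seq (T * T)) : {perm T} :=
  (\prod_(t <- w) tperm t.1 t.2)%g.

(** Indexing by a sequence over any type lets the words of a combination, or pairs of points, serve
    as indices even when several of them denote the same group element. *)
Definition pos_type (C : numClosedFieldType) (gT : finGroupType) (f : gT -> C) :=
  forall (S : Type) (s : seq S) (c : S -> C) (g : S -> gT),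
    0 <= \sum_(a <- s) \sum_(b <- s) c a * (c b)^* * f (g a * (g b)^-1)%g.

Section Values.
Variables (C : numClosedFieldType) (T : finType) (f : {perm T} -> C).

Definition value (E : comb T) : C := \sum_(e <- E) e.1%:~R * f (@wperm T e.2).

Lemma value_cat E1 E2 : value (E1 ++ E2) = value E1 + value E2.
Proof. exact: big_cat. Qed.

Lemma value_scale c E : value (comb_scale c E) = c%:~R * value E.
Proof.
rewrite /value big_map mulr_sumr; apply: eq_bigr => e _ /=.
by rewrite intrM mulrA.
Qed.

Lemma wperm_rev (w : seq (T * T)) : wperm (rev w) = (wperm w)^-1%g.
Proof.
rewrite /wperm; elim: w => [|t w IHw]; first by rewrite /rev /= !big_nil invg1.
by rewrite rev_cons -cats1 big_cat !big_cons big_nil /= mulg1 IHw invMg tpermV.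
Qed.

Lemma value_mulstar_ge0 E : pos_type f -> 0 <= value (comb_mulstar E).
Proof.
move=> fP; rewrite /value /comb_mulstar big_allpairs_dep /=.
have := fP _ E (fun e => e.1%:~R) (fun e => wperm e.2).
congr (0 <= _); apply: eq_bigr => a _; apply: eq_bigr => b _.
rewrite conj_Creal ?realz // -intrM; congr (_ * f _).
by rewrite -wperm_rev /wperm big_cat.
Qed.

Section Relabel.
Variables (m : nat) (pt : nat -> T).
Hypothesis pt_inj : {in gtn m &, injective pt}.

Local Notation wmap w := [seq (pt t.1, pt t.2) | t <- w].

Lemma wperm_act w a : word_in m w -> (a < m)%N ->
  wperm (wmap w) (pt a) = pt (word_act w a).
Proof.
rewrite /wperm /word_act; elim: w a => [|[b c] w IHw] a /=.
  by rewrite big_nil perm1.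
case/andP=> /andP[/= lt_b lt_c] w_in lt_a; rewrite big_cons permM /=.
have [->|ne_ab] := eqVneq a b; first by rewrite tpermL IHw.
have [->|ne_ac] := eqVneq a c; first by rewrite tpermR IHw.
by rewrite tpermD ?IHw // eq_sym (inj_in_eq pt_inj).
Qed.

Lemma wperm_out w y : word_in m w -> (forall a, (a < m)%N -> y != pt a) ->
  wperm (wmap w) y = y.
Proof.
rewrite /wperm => w_in out_y; elim: w w_in => [|[b c] w IHw] /=.
  by rewrite big_nil perm1.
case/andP=> /andP[/= lt_b lt_c] w_in; rewrite big_cons permM /=.
by rewrite tpermD ?IHw // eq_sym out_y.
Qed.

(** [f] at the only permutation that has table [t] on the points [pt a] and fixes all other points,
    so that the value of a word depends only on its table; 0 is the default when there is no such
    permutation. *)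
Definition table_value (t : seq nat) : C :=
  if [pick g : {perm T} | [forall a : 'I_m, g (pt a) == pt (nth 0%N t a)] &&
        [forall y, [forall a : 'I_m, y != pt a] ==> (g y == y)]] is Some g
  then f g else 0.

Lemma table_valueE w : word_in m w ->
  f (wperm (wmap w)) = table_value (word_table m w).
Proof.
move=> w_in; rewrite /table_value; case: pickP => [g | /(_ (wperm (wmap w)))].
  case/andP=> /forallP gP /forallP g_out; congr f; apply/permP => y.
  have [/existsP[a /eqP->]|] := boolP [exists a : 'I_m, y == pt a].
    rewrite wperm_act // (eqP (gP a)) (nth_map 0%N) ?size_iota //.
    by rewrite nth_iota.
  rewrite negb_exists => out_y; rewrite (eqP (implyP (g_out y) out_y)).
  by rewrite wperm_out // => a lt_a; apply: (forallP out_y (Ordinal lt_a)).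
move/negP; case; apply/andP; split; apply/forallP; [move=> a | move=> y].
  by rewrite wperm_act // (nth_map 0%N) ?size_iota // nth_iota.
apply/implyP=> /forallP out_y.
by rewrite wperm_out // => a lt_a; apply: (out_y (Ordinal lt_a)).
Qed.

Lemma sum_collect D c t :
  \sum_(d <- collect D c t) d.1%:~R * table_value d.2 =
    c%:~R * table_value t + \sum_(d <- D) d.1%:~R * table_value d.2.
Proof.
elim: D => [|d D IHD] /=; first by rewrite big_seq1 big_nil addr0.
have [->|_] := eqVneq t d.2; first by rewrite !big_cons intrD mulrDl addrA.
by rewrite !big_cons IHD addrCA.
Qed.

(** Grouping the words by table leaves only zero coefficients. A closed computation on the labels
    below [m] thus yields an identity for every choice of [m] distinct points. *)
Lemma value_balanced E : balanced m E -> value (comb_map pt E) = 0.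
Proof.
case/andP=> E_in /allP E0.
transitivity (\sum_(d <- foldr (fun e D => collect D e.1 (word_table m e.2)) [::] E)
  d.1%:~R * table_value d.2); last first.
  by rewrite big_seq big1 // => d /E0/eqP->; rewrite mul0r.
rewrite /value /comb_map big_map; elim: E E_in {E0} => [|e E IHE] /=.
  by rewrite !big_nil.
by case/andP=> e_in E_in; rewrite sum_collect big_cons IHE // -table_valueE.
Qed.

Lemma value_map_cat : {morph value \o comb_map pt : E1 E2 / E1 ++ E2 >-> E1 + E2}.
Proof. by move=> E1 E2; rewrite /= /comb_map map_cat value_cat. Qed.

Lemma comb_map_scale c E :
  comb_map pt (comb_scale c E) = comb_scale c (comb_map pt E).
Proof. by rewrite /comb_map /comb_scale -!map_comp. Qed.

Lemma value_balancedB c E1 E2 : balanced m (E1 ++ comb_scale (- c) E2) ->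
  value (comb_map pt E1) = c%:~R * value (comb_map pt E2).
Proof.
move/value_balanced; rewrite /comb_map map_cat value_cat.
rewrite -![map _ _]/(comb_map _ _) comb_map_scale value_scale intrN mulNr.
by move/eqP; rewrite subr_eq0 => /eqP.
Qed.

Lemma comb_map_mulstar E :
  comb_map pt (comb_mulstar E) = comb_mulstar (comb_map pt E).
Proof.
rewrite /comb_map /comb_mulstar map_allpairs allpairs_mapl allpairs_mapr.
by apply: eq_allpairs => // a b; rewrite map_cat map_rev.
Qed.

(** The value of [E] is one twelfth of that of [E] times its adjoint, which is nonnegative by
    positive type. Both [quad] and [quint] satisfy this relation. *)
Lemma value_ge0 E : pos_type f ->
  balanced m (comb_mulstar E ++ comb_scale (- 12%:Z) E) ->
  0 <= value (comb_map pt E).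
Proof.
move=> fP /value_balancedB; rewrite comb_map_mulstar => sqE.
by have := value_mulstar_ge0 (comb_map pt E) fP; rewrite sqE pmulr_rge0 ?ltr0n.
Qed.

End Relabel.

End Values.

(** * Quartic forms in the weights *)

Section Quartic.
Variables (C : comNzRingType) (I : finType) (y : I -> C).

(** The nesting lets facts about a single weighted sum be applied at each of the four levels. *)
Definition quartic (F : I -> I -> I -> I -> C) : C :=
  \sum_i y i * (\sum_j y j * (\sum_k y k * (\sum_l y l * F i j k l))).

Lemma eq_quartic F G : (forall i j k l, F i j k l = G i j k l) ->
  quartic F = quartic G.
Proof.
move=> eqFG; apply: eq_bigr => i _; congr (_ * _); apply: eq_bigr => j _.
congr (_ * _); apply: eq_bigr => k _; congr (_ * _).
by apply: eq_bigr => l _; rewrite eqFG.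
Qed.

Lemma quarticD F G :
  quartic (fun i j k l => F i j k l + G i j k l) = quartic F + quartic G.
Proof.
rewrite /quartic -big_split; apply: eq_bigr => i _ /=; rewrite -mulrDr -big_split.
congr (_ * _); apply: eq_bigr => j _ /=; rewrite -mulrDr -big_split.
congr (_ * _); apply: eq_bigr => k _ /=; rewrite -mulrDr -big_split.
by congr (_ * _); apply: eq_bigr => l _ /=; rewrite -mulrDr.
Qed.

Lemma weightedZ c (g : I -> C) :
  \sum_i y i * (c * g i) = c * \sum_i y i * g i.
Proof. by rewrite mulr_sumr; apply: eq_bigr => i _; rewrite mulrCA. Qed.

Lemma quarticZ c F : quartic (fun i j k l => c * F i j k l) = c * quartic F.
Proof.
rewrite -weightedZ; apply: eq_bigr => i _; congr (_ * _).
rewrite -weightedZ; apply: eq_bigr => j _; congr (_ * _).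
rewrite -weightedZ; apply: eq_bigr => k _; congr (_ * _).
exact: weightedZ.
Qed.

Lemma weighted_swap (g : I -> I -> C) :
  \sum_i y i * (\sum_j y j * g i j) = \sum_i y i * (\sum_j y j * g j i).
Proof.
under eq_bigr do rewrite mulr_sumr; rewrite exchange_big /=.
apply: eq_bigr => i _; rewrite mulr_sumr; apply: eq_bigr => j _.
by rewrite mulrCA.
Qed.

Lemma quartic_swap12 F : quartic (fun i j k l => F j i k l) = quartic F.
Proof. exact: weighted_swap. Qed.

Lemma quartic_swap23 F : quartic (fun i j k l => F i k j l) = quartic F.
Proof. by apply: eq_bigr => i _; rewrite weighted_swap. Qed.

Lemma quartic_swap34 F : quartic (fun i j k l => F i j l k) = quartic F.
Proof.
apply: eq_bigr => i _; congr (_ * _); apply: eq_bigr => j _.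
by rewrite weighted_swap.
Qed.

Lemma quartic_swap13 F : quartic (fun i j k l => F k j i l) = quartic F.
Proof.
rewrite (quartic_swap12 (fun i j k l => F k i j l)).
by rewrite (quartic_swap23 (fun i j k l => F j i k l)) quartic_swap12.
Qed.

Lemma quartic_swap24 F : quartic (fun i j k l => F i l k j) = quartic F.
Proof.
rewrite (quartic_swap23 (fun i j k l => F i l j k)).
by rewrite (quartic_swap34 (fun i j k l => F i k j l)) quartic_swap23.
Qed.

Lemma quartic_swap14 F : quartic (fun i j k l => F l j k i) = quartic F.
Proof.
rewrite (quartic_swap12 (fun i j k l => F l i k j)).
by rewrite (quartic_swap24 (fun i j k l => F j i k l)) quartic_swap12.
Qed.

(** The weights commute, so all 2 * 3 * 4 orderings of the arguments contribute equally. *)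
Lemma quartic_symm4 F : quartic (symm4 +%R F) = 24%:R * quartic F.
Proof.
have q2 G : quartic (st2 +%R G) = 2%:R * quartic G.
  by rewrite (quarticD G (fun i j k l => G j i k l)) quartic_swap12; ring.
have q3 G : quartic (st3 +%R G) = 3%:R * quartic G.
  rewrite (quarticD G (fun i j k l => G i k j l + G k j i l)).
  rewrite (quarticD (fun i j k l => G i k j l) (fun i j k l => G k j i l)).
  by rewrite (quartic_swap23 G) (quartic_swap13 G); ring.
have q4 G : quartic (st4 +%R G) = 4%:R * quartic G.
  rewrite (quarticD G (fun i j k l => G i j l k + (G i l k j + G l j k i))).
  rewrite (quarticD (fun i j k l => G i j l k)
             (fun i j k l => G i l k j + G l j k i)).
  rewrite (quarticD (fun i j k l => G i l k j) (fun i j k l => G l j k i)).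
  by rewrite (quartic_swap34 G) (quartic_swap24 G) (quartic_swap14 G); ring.
by rewrite q4 q3 q2; ring.
Qed.

(** The innermost sum is a constant times the total weight. *)
Lemma quartic_indep4 (F : I -> I -> I -> C) : \sum_i y i = 0 ->
  quartic (fun i j k l => F i j k) = 0.
Proof.
move=> y0; apply: big1 => i _; rewrite big1 ?mulr0 // => j _.
by rewrite big1 ?mulr0 // => k _; rewrite -mulr_suml y0 mul0r mulr0.
Qed.

Lemma quartic_diag34 (g : I -> I -> C) :
  quartic (fun i j k l => (k == l)%:R * g i j) =
    (\sum_i y i * (\sum_j y j * g i j)) * \sum_k y k ^+ 2.
Proof.
rewrite mulr_suml; apply: eq_bigr => i _; rewrite -mulrA; congr (_ * _).
rewrite mulr_suml; apply: eq_bigr => j _; rewrite -mulrA; congr (_ * _).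
rewrite [RHS]mulr_sumr; apply: eq_bigr => k _.
rewrite (bigD1 k) //= eqxx big1 => [|l].
  by rewrite mul1r addr0 mulrA -expr2 mulrC.
by rewrite eq_sym => /negPf->; rewrite mul0r mulr0.
Qed.

End Quartic.

(** * The symmetrized defect: its support and its sign *)

Lemma symm4_morph (T A B : Type) (addA : A -> A -> A) (addB : B -> B -> B)
    (h : A -> B) (hD : {morph h : a b / addA a b >-> addB a b})
    (F : T -> T -> T -> T -> A) i j k l :
  h (symm4 addA F i j k l) = symm4 addB (fun i j k l => h (F i j k l)) i j k l.
Proof. by rewrite /symm4 /st4 /st3 /st2 !hD. Qed.

Lemma nth_in_inj (T : eqType) (x0 : T) (s : seq T) :
  uniq s -> {in gtn (size s) &, injective (nth x0 s)}.
Proof. by move=> s_uniq a b a_s b_s /eqP; rewrite nth_uniq // => /eqP. Qed.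

Section SymmetricDefect.
Variables (C : numClosedFieldType) (T : finType) (f : {perm T} -> C).
Hypothesis f_pos : pos_type f.

(** Symmetrizing changes the quartic form only by the factor 24, but concentrates it on quadruples
    of distinct points, where it is a multiple of M_ijkl. *)
Definition sdefect : T -> T -> T -> T -> C :=
  symm4 +%R (fun i j k l => value f (defect i j k l)).

Lemma sdefect_swap12 i j k l : sdefect j i k l = sdefect i j k l.
Proof. by rewrite /sdefect /symm4 /st4 /st3 /st2; ring. Qed.

Lemma sdefect_swap23 i j k l : sdefect i k j l = sdefect i j k l.
Proof. by rewrite /sdefect /symm4 /st4 /st3 /st2; ring. Qed.

Lemma sdefect_swap34 i j k l : sdefect i j l k = sdefect i j k l.
Proof. by rewrite /sdefect /symm4 /st4 /st3 /st2; ring. Qed.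

(** Passage from points to labels; injectivity of [pt] enters because [defect] tests its arguments
    for equality. *)
Lemma sdefect_map m (pt : nat -> T) a b c d :
  {in gtn m &, injective pt} -> all (gtn m) [:: a; b; c; d] ->
  sdefect (pt a) (pt b) (pt c) (pt d) =
    value f (comb_map pt (symm4 (@cat _) (@defect nat) a b c d)).
Proof.
move=> pt_inj /and5P[a_m b_m c_m d_m _].
have defect_map a' b' c' d' :
    (a' < m)%N -> (b' < m)%N -> (c' < m)%N -> (d' < m)%N ->
    value f (defect (pt a') (pt b') (pt c') (pt d')) =
      value f (comb_map pt (defect a' b' c' d')).
  by move=> *; rewrite /comb_map /defect /= !(inj_in_eq pt_inj).
rewrite -[RHS]/((value f \o comb_map pt) _) (symm4_morph (value_map_cat f pt)).
by rewrite /sdefect /symm4 /st4 /st3 /st2 !defect_map.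
Qed.

Lemma sdefect_nth_eq0 (s : seq T) (x0 : T) a b c d :
  uniq s -> all (gtn (size s)) [:: a; b; c; d] ->
  balanced (size s) (symm4 (@cat _) (@defect nat) a b c d) ->
  sdefect (nth x0 s a) (nth x0 s b) (nth x0 s c) (nth x0 s d) = 0.
Proof.
move=> /(@nth_in_inj _ x0 _) s_inj s_abcd /(value_balanced f s_inj) <-.
exact: sdefect_map s_inj _.
Qed.

(** Each pattern of coincidences among [i], [k], [l] is a finite check on at most three labels. *)
Lemma sdefect_diag i k l : sdefect i i k l = 0.
Proof.
have [->|ne_ki] := eqVneq k i.
  have [->|ne_li] := eqVneq l i.
    by apply: (@sdefect_nth_eq0 [:: i] i 0 0 0 0)%N.
  by apply: (@sdefect_nth_eq0 [:: i; l] i 0 0 0 1)%N => //;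
    rewrite /= inE eq_sym ne_li.
have [->|ne_li] := eqVneq l i.
  by apply: (@sdefect_nth_eq0 [:: i; k] i 0 0 1 0)%N => //;
    rewrite /= inE eq_sym ne_ki.
have [->|ne_lk] := eqVneq l k.
  by apply: (@sdefect_nth_eq0 [:: i; k] i 0 0 1 1)%N => //;
    rewrite /= inE eq_sym ne_ki.
apply: (@sdefect_nth_eq0 [:: i; k; l] i 0 0 1 2)%N => //.
by rewrite /= !inE negb_or ![i == _]eq_sym ne_ki ne_li eq_sym ne_lk.
Qed.

(** By symmetry, a coinciding pair can be moved to the first two places. *)
Lemma sdefect_eq0 i j k l : ~~ uniq [:: i; j; k; l] -> sdefect i j k l = 0.
Proof.
rewrite /= !inE !negb_and !negbK -!orbA orbF.
case/or4P=> [/eqP->|/eqP->|/eqP->|]; first exact: sdefect_diag.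
- by rewrite sdefect_swap23 sdefect_diag.
- by rewrite -sdefect_swap34 sdefect_swap23 sdefect_diag.
case/or3P=> /eqP->.
- by rewrite -sdefect_swap12 -sdefect_swap23 sdefect_diag.
- by rewrite -sdefect_swap34 -sdefect_swap12 -sdefect_swap23 sdefect_diag.
- by rewrite -sdefect_swap23 -sdefect_swap12 -sdefect_swap34
    -sdefect_swap23 sdefect_diag.
Qed.

(** Over the 24 orderings, the identity gets coefficient -24, each double transposition 8 * (-3) and
    each three-cycle 3 * 4, while the terms carrying an equality test drop out: this is -12
    M_ijkl. *)
Lemma sdefect_uniq i j k l : uniq [:: i; j; k; l] ->
  sdefect i j k l = (- 12)%:~R * value f (quad i j k l).
Proof.
move=> s_uniq; have s_inj := @nth_in_inj _ i _ s_uniq.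
have -> := @sdefect_map 4 (nth i [:: i; j; k; l]) 0 1 2 3 s_inj isT.
by rewrite (@value_balancedB _ _ f 4 _ s_inj (-12) _ (quad 0 1 2 3)%N).
Qed.

Lemma quad_ge0 i j k l : uniq [:: i; j; k; l] -> 0 <= value f (quad i j k l).
Proof.
move=> s_uniq; have s_inj := @nth_in_inj _ i _ s_uniq.
by apply: (@value_ge0 _ _ f 4 _ s_inj (quad 0 1 2 3)%N).
Qed.

Lemma sdefect_le0 i j k l : sdefect i j k l <= 0.
Proof.
have [s_uniq|/sdefect_eq0-> //] := boolP (uniq [:: i; j; k; l]).
by rewrite sdefect_uniq // mulrNz mulNr oppr_le0 mulr_ge0 ?quad_ge0 ?ler0n.
Qed.

(** The difference of the two sides is twice N: three-cycles avoiding [p] cancel, and those through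
    [p] occur in two of the four quads on the right. *)
Lemma quint_ge0 i j k l p : uniq [:: i; j; k; l; p] ->
  value f (quad i j k l) <= value f (quad i j k p) + value f (quad i j l p)
    + value f (quad i k l p) + value f (quad j k l p).
Proof.
move=> s_uniq; have s_inj := @nth_in_inj _ i _ s_uniq.
have := @value_ge0 _ _ f 5 _ s_inj (quint 0 1 2 3 4)%N f_pos isT.
have := @value_balancedB _ _ f 5 _ s_inj 2
  (quad 0 1 2 4 ++ quad 0 1 3 4 ++ quad 0 2 3 4 ++ quad 1 2 3 4 ++
   comb_scale (-1) (quad 0 1 2 3))%N (quint 0 1 2 3 4)%N isT.
rewrite /comb_map !map_cat !value_cat -![map _ _]/(comb_map _ _).
rewrite comb_map_scale value_scale mulrNz mulNr mul1r !addrA => eq_quint.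
by rewrite -(pmulr_rge0 _ (_ : 0 < 2%:~R)) ?ltr0n // -eq_quint subr_ge0.
Qed.

(** This is the coefficient of y_i y_j y_k y_l in the quartic form once the weight of the last point
    [p] is eliminated. On distinct points it is 12 times the gap in [quint_ge0]; otherwise the first
    term vanishes and the subtracted ones are at most 0. *)
Lemma sdefect_alternating_ge0 i j k l p : p \notin [:: i; j; k; l] ->
  0 <= sdefect i j k l - sdefect i j k p - sdefect i j l p
         - sdefect i k l p - sdefect j k l p.
Proof.
move=> p_out; have [s_uniq|/sdefect_eq0->] := boolP (uniq [:: i; j; k; l]).
  have uniq5 : uniq [:: i; j; k; l; p] by rewrite (rcons_uniq [:: i; j; k; l]) p_out.
  have le_quad := quint_ge0 uniq5.
  have [u1 u2 u3 u4] : [/\ uniq [:: i; j; k; p], uniq [:: i; j; l; p],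
      uniq [:: i; k; l; p] & uniq [:: j; k; l; p]].
    by move: uniq5; rewrite /= !inE !negb_or; do !case: (_ == _).
  rewrite !sdefect_uniq // -!mulrBr !mulrNz mulNr -mulrN mulr_ge0 ?ler0n //.
  by rewrite oppr_ge0 -!addrA -!opprD subr_le0 !addrA.
by rewrite sub0r !addr_ge0 ?oppr_ge0 ?sdefect_le0.
Qed.

End SymmetricDefect.

(** * Positivity of the form Q for weights of total zero *)

Section OctopusForm.
Variables (C : numClosedFieldType) (m : nat) (f : {perm 'I_m.+1} -> C).
Hypothesis f_pos : pos_type f.
Variable y : 'I_m.+1 -> C.
Hypothesis y_ge0 : forall i : 'I_m, 0 <= y (widen_ord (leqnSn m) i).
Hypothesis y_sum0 : \sum_i y i = 0.

Local Notation inc := (widen_ord (leqnSn m)).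

Lemma weight_last : y ord_max = - \sum_(i < m) y (inc i).
Proof. by apply/eqP; rewrite -addr_eq0 addrC -big_ord_recr y_sum0. Qed.

Lemma weight_real i : y i \is Num.real.
Proof.
have inc_real j : y (inc j) \is Num.real by rewrite ger0_real.
have [j ->|->] := unliftP ord_max i.
  suff -> : lift ord_max j = inc j by [].
  by apply: val_inj; rewrite /= /bump leqNgt ltn_ord.
by rewrite weight_last rpredN rpred_sum.
Qed.

(** Substituting minus the sum of the others for the last weight leaves nonnegative weights only;
    applied at each level, this makes the sign of a quartic form visible. *)
Lemma weighted_sum_last (g : 'I_m.+1 -> C) :
  \sum_i y i * g i = \sum_(i < m) y (inc i) * (g (inc i) - g ord_max).
Proof.
rewrite big_ord_recr /= weight_last mulNr mulr_suml -sumrB.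
by apply: eq_bigr => i _; rewrite mulrBr.
Qed.

(** Positive type applies to Q times its adjoint, which is Q^2 since the weights are real and
    transpositions are involutions. *)
Lemma quartic_tperm2_ge0 :
  0 <= quartic y (fun i j k l => f (tperm i j * tperm k l)%g).
Proof.
have := f_pos (index_enum ('I_m.+1 * 'I_m.+1)%type)
  (fun t => y t.1 * y t.2) (fun t => tperm t.1 t.2).
rewrite -(pair_bigA _ (fun i j => \sum_(b : 'I_m.+1 * 'I_m.+1)
  y i * y j * (y b.1 * y b.2)^* * f (tperm i j * (tperm b.1 b.2)^-1)%g)) /=.
congr (0 <= _); apply: eq_bigr => i _; rewrite mulr_sumr; apply: eq_bigr => j _.
rewrite -(pair_bigA _ (fun k l =>
  y i * y j * (y k * y l)^* * f (tperm i j * (tperm k l)^-1)%g)) /=.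
rewrite mulrA mulr_sumr; apply: eq_bigr => k _.
rewrite mulrA mulr_sumr; apply: eq_bigr => l _.
by rewrite tpermV conj_Creal ?rpredM ?weight_real // !mulrA.
Qed.

Lemma quartic_sdefect_ge0 : 0 <= quartic y (sdefect f).
Proof.
rewrite /quartic weighted_sum_last; apply: sumr_ge0 => i _.
rewrite !weighted_sum_last -sumrB mulr_ge0 //; apply: sumr_ge0 => j _.
rewrite -mulrBr !weighted_sum_last -!sumrB mulr_ge0 //; apply: sumr_ge0 => k _.
rewrite -!mulrBr !weighted_sum_last -!sumrB mulr_ge0 //; apply: sumr_ge0 => l _.
rewrite -!mulrBr mulr_ge0 //.
have inc_out : ord_max \notin [:: inc i; inc j; inc k; inc l].
  rewrite !inE !negb_or -!(inj_eq val_inj) /=.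
  by rewrite ![m == _]eq_sym !ltn_eqF ?ltn_ord.
have := sdefect_alternating_ge0 f_pos inc_out; congr (0 <= _).
(* Expanding the differences in the four arguments gives sixteen signed terms. The eleven with [p]
   at least twice vanish, and swaps bring the single [p] of four others to the last place. *)
set p := ord_max.
have z12 c d : sdefect f p p c d = 0 := sdefect_diag f p c d.
have z13 b d : sdefect f p b p d = 0 by rewrite -sdefect_swap23.
have z14 b c : sdefect f p b c p = 0 by rewrite -sdefect_swap34.
have z23 a d : sdefect f a p p d = 0 by rewrite -sdefect_swap12.
have z24 a c : sdefect f a p c p = 0 by rewrite -sdefect_swap12.
have z34 a b : sdefect f a b p p = 0 by rewrite -sdefect_swap23.
rewrite !(z12, z13, z14, z23, z24, z34) (sdefect_swap34 f _ _ (inc l) p).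
rewrite (sdefect_swap23 f _ (inc k) p) (sdefect_swap34 f _ _ (inc l) p).
rewrite (sdefect_swap12 f (inc j) p) (sdefect_swap23 f _ (inc k) p).
by rewrite (sdefect_swap34 f _ _ (inc l) p) !subr0.
Qed.

(** The quartic form of [defect] is 6 q D - 3 S2 and is nonnegative by symmetrization. As S2 >= 0,
    also q D >= 0, and D > 0 unless all weights vanish. *)
Lemma octopus_form_ge0 : 0 <= \sum_i y i * (\sum_j y j * f (tperm i j)).
Proof.
set q := \sum_i _; set D := \sum_k y k ^+ 2.
have sq_ge0 k : 0 <= y k ^+ 2 by rewrite real_exprn_even_ge0 ?weight_real.
have [D0|D_neq0] := eqVneq D 0.
  have y0 k : y k = 0.
    have /eqP := psumr_eq0P (fun k _ => sq_ge0 k) D0 (erefl : true) (i := k).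
    by rewrite expf_eq0 /= => /eqP.
  by rewrite /q big1 // => k _; rewrite y0 mul0r.
have D_gt0 : 0 < D by rewrite lt_neqAle eq_sym D_neq0 sumr_ge0.
pose S2 := quartic y (fun i j k l => f (tperm i j * tperm k l)%g).
(* The terms of [defect] that do not involve [l], which the zero total weight removes. *)
pose rest i j k := 4%:R * f (tperm i j * tperm j k)%g
  - 8%:R * ((i == j)%:R * f (tperm i k)) + 2%:R * ((i == j)%:R * f 1%g) - f 1%g.
have defectE i j k l : value f (defect i j k l) =
    6%:R * ((k == l)%:R * f (tperm i j))
    + ((-3%:R) * f (tperm i j * tperm k l)%g + rest i j k).
  rewrite /value /defect !big_cons big_nil /wperm !big_cons !big_nil /= !mulg1.
  by rewrite /rest; do !case: eqP => _ /=; ring.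
have eq_defect : quartic y (fun i j k l => value f (defect i j k l)) =
    6%:R * (q * D) - 3%:R * S2.
  rewrite (eq_quartic _ defectE).
  rewrite (quarticD y (fun i j k l => 6%:R * ((k == l)%:R * f (tperm i j)))
    (fun i j k l => (-3%:R) * f (tperm i j * tperm k l)%g + rest i j k)).
  rewrite (quarticD y (fun i j k l => (-3%:R) * f (tperm i j * tperm k l)%g)
    (fun i j k l => rest i j k)).
  rewrite (quarticZ y (6%:R) (fun i j k l => (k == l)%:R * f (tperm i j))).
  rewrite (quarticZ y (-3%:R) (fun i j k l => f (tperm i j * tperm k l)%g)).
  rewrite (quartic_diag34 y (fun i j => f (tperm i j))).
  by rewrite (quartic_indep4 rest) // addr0 mulNr.
have := quartic_sdefect_ge0; rewrite quartic_symm4 eq_defect.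
rewrite pmulr_rge0 ?ltr0n // subr_ge0 => le_qD.
have : 0 <= 6%:R * (q * D).
  by apply: le_trans le_qD; rewrite mulr_ge0 ?ler0n ?quartic_tperm2_ge0.
by rewrite pmulr_rge0 ?ltr0n // pmulr_lge0.
Qed.

End OctopusForm.

(** * The group ring and its unitary representations *)

Section GroupRing.
Variables (C : numClosedFieldType) (gT : finGroupType) (G : {group gT}).
Local Open Scope sesquilinear_scope.

Lemma gring_coef_repr g h : g \in G -> h \in G ->
  gring_coef (regular_repr C G g) h = (h == g)%:R.
Proof.
move=> Gg Gh; rewrite /gring_coef /gring_row mxE.
rewrite mxE gring_indexK // mul1g mxE eqxx /=.
by rewrite (can_in_eq (@gring_indexK _ G)).
Qed.

Definition gring_selfadj (A : 'M[C]_#|G|) : Prop :=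
  (A \in group_ring C G)%MS /\ gring_star A = A.

Lemma gring_selfadjB A B :
  gring_selfadj A -> gring_selfadj B -> gring_selfadj (A - B).
Proof.
move=> [RA sA] [RB sB]; split; first by rewrite linearB addmx_sub ?eqmx_opp.
rewrite -{2}sA -{2}sB /gring_star -sumrB; apply: eq_bigr => g _.
by rewrite /gring_coef linearB !mxE rmorphB scalerBl.
Qed.

Lemma gring_selfadjZ c A :
  c \is Num.real -> gring_selfadj A -> gring_selfadj (c *: A).
Proof.
move=> c_real [RA sA]; split; first by rewrite linearZ scalemx_sub.
rewrite -{2}sA /gring_star scaler_sumr; apply: eq_bigr => g _.
by rewrite /gring_coef linearZ !mxE rmorphM /= conj_Creal // scalerA.
Qed.

Lemma gring_selfadj_inv g : g \in G -> (g^-1 = g)%g ->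
  gring_selfadj (regular_repr C G g).
Proof.
move=> Gg g_inv; split; first exact: envelop_mx_id.
rewrite /gring_star (bigD1 g) //= gring_coef_repr // eqxx conjC1 scale1r g_inv.
rewrite big1 ?addr0 // => h /andP[Gh ne_hg].
by rewrite gring_coef_repr // (negPf ne_hg) conjC0 scale0r.
Qed.

Lemma gring_selfadj_sum (I : Type) (r : seq I) (P : pred I)
    (F : I -> 'M[C]_#|G|) :
  (forall i, gring_selfadj (F i)) -> gring_selfadj (\sum_(i <- r | P i) F i).
Proof.
(* Zero and sums are obtained from real multiples and differences. *)
move=> sF; apply: (big_ind gring_selfadj) => // [|A B sA sB].
  have := gring_selfadjZ (real0 C) (gring_selfadj_inv (group1 G) (invg1 gT)).
  by rewrite scale0r.
have N1_real : (-1 : C) \is Num.real by rewrite rpredN real1.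
have := gring_selfadjB sA (gring_selfadjZ N1_real sB).
by rewrite scaleN1r opprK.
Qed.

Section Repr.
Variables (d : nat) (rG : mx_representation C G d).
Hypothesis rG_unitary : unitary_repr rG.

Lemma unitary_reprV g : g \in G -> rG (g^-1)%g = (rG g)^t*.
Proof.
by move=> Gg; rewrite repr_mxV // invmx_unitary // rG_unitary.
Qed.

Lemma gring_op_sum A : gring_op rG A = \sum_(g in G) gring_coef A g *: rG g.
Proof.
rewrite gring_opE /gring_mx /= mulmx_sum_row linear_sum /= [RHS]big_enum_val /=.
apply: eq_bigr => i _; rewrite linearZ /= rowK mxvecK.
by rewrite /gring_coef gring_valK.
Qed.

(** A unitary representation turns the star into the conjugate transpose, since it does so for the
    inverse of each group element. *)
Lemma gring_op_selfadj A : gring_selfadj A -> gring_op rG A \is hermsymmx.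
Proof.
case=> _ sA; apply/is_hermitianmxP; rewrite expr0 scale1r.
rewrite -{1}sA /gring_star linear_sum /= gring_op_sum.
rewrite linear_sum raddf_sum /=; apply: eq_bigr => g Gg.
by rewrite !linearZ /= gring_opG ?groupV // map_mxZ unitary_reprV.
Qed.

End Repr.

End GroupRing.

Section UnitaryForm.
Variables (C : numClosedFieldType) (gT : finGroupType) (d : nat).
Variable rG : mx_representation C [set: gT]%G d.
Hypothesis rG_unitary : unitary_repr rG.
Variable v : 'rV[C]_d.
Local Open Scope sesquilinear_scope.

Definition gring_form (A : 'M[C]_#|[set: gT]|) : C :=
  (v *m gring_op rG A *m v^t*) 0 0.

Lemma gring_form_sum (I : Type) (r : seq I) (P : pred I) F :
  gring_form (\sum_(i <- r | P i) F i) = \sum_(i <- r | P i) gring_form (F i).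
Proof. by rewrite /gring_form linear_sum mulmx_sumr mulmx_suml summxE. Qed.

Lemma gring_formZ c A : gring_form (c *: A) = c * gring_form A.
Proof. by rewrite /gring_form linearZ -scalemxAr -scalemxAl mxE. Qed.

Lemma gring_formB A B : gring_form (A - B) = gring_form A - gring_form B.
Proof.
rewrite -scaleN1r /gring_form linearD linearZ mulmxDr mulmxDl.
by rewrite -scalemxAr -scalemxAl mxE [X in _ + X]mxE mulN1r.
Qed.

(** The double sum is the squared norm of [u], the combination of the vectors v rho(g_a) with
    coefficients c_a. *)
Lemma pos_type_unitary :
  pos_type (fun g => gring_form (regular_repr C [set: gT]%G g)).
Proof.
move=> S s c g; pose u := \sum_(a <- s) c a *: (v *m rG (g a)).
have -> : \sum_(a <- s) \sum_(b <- s) c a * (c b)^* *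
    gring_form (regular_repr C [set: gT]%G (g a * (g b)^-1)%g) = (u *m u^t*) 0 0.
  rewrite /u mulmx_suml summxE; apply: eq_bigr => a _.
  rewrite linear_sum raddf_sum mulmx_sumr summxE; apply: eq_bigr => b _ /=.
  rewrite linearZ /= map_mxZ trmx_mul map_mxM -scalemxAl -scalemxAr scalerA.
  rewrite /gring_form gring_opG ?inE //.
  by rewrite repr_mxM ?inE // unitary_reprV ?inE // [RHS]mxE !mulmxA.
rewrite mxE sumr_ge0 // => i _; rewrite !mxE.
by rewrite mul_conjC_ge0.
Qed.

End UnitaryForm.

(** * From the form Q to the inequality in the group algebra *)

Lemma sum_symmetric_lt (V : nmodType) (m : nat) (F : 'I_m -> 'I_m -> V) :
    (forall i j, F i j = F j i) -> (forall i, F i i = 0) ->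
  \sum_i \sum_j F i j = (\sum_(i < m) \sum_(j < m | (i < j)%N) F i j) *+ 2.
Proof.
move=> F_sym F_diag.
rewrite mulr2n [X in _ = _ + X](exchange_big_dep xpredT) //= -big_split.
apply: eq_bigr => i _ /=; rewrite (bigID (fun j : 'I_m => (i < j)%N)) /=.
congr (_ + _); rewrite (bigD1 i) ?ltnn //= F_diag add0r.
apply: eq_big => [j|j _]; last by [].
by rewrite -leqNgt ltn_neqAle andbC.
Qed.

(** Twice the difference of the two sides is the form of [octopus_form_ge0] for the weights [x]
    extended by minus their sum at the last point. *)
Lemma octopus_pos_type (C : numClosedFieldType) (m : nat)
    (f : {perm 'I_m.+1} -> C) (x : 'I_m -> C) (inc : 'I_m -> 'I_m.+1) :
    pos_type f -> (forall i, 0 <= x i) -> (forall i, inc i = i :> nat) ->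
  \sum_(i < m) \sum_(j < m | (i < j)%N)
      x i * x j * (f 1%g - f (tperm (inc i) (inc j))) <=
    (\sum_i x i) * (\sum_i x i * (f 1%g - f (tperm (inc i) ord_max))).
Proof.
move=> f_pos x_ge0 inc_val.
have incE i : widen_ord (leqnSn m) i = inc i by apply: val_inj; rewrite /= inc_val.
pose y i := if unlift ord_max i is Some j then x j else - \sum_j x j.
have y_inc i : y (inc i) = x i.
  have -> : inc i = lift ord_max i.
    by apply: val_inj; rewrite /= /bump inc_val leqNgt ltn_ord.
  by rewrite /y liftK.
have y_sum0 : \sum_i y i = 0.
  rewrite big_ord_recr /= {2}/y unlift_none.
  by rewrite (eq_bigr x) ?subrr // => i _; rewrite incE y_inc.
have y_ge0 i : 0 <= y (widen_ord (leqnSn m) i) by rewrite incE y_inc.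
have := octopus_form_ge0 f_pos y_ge0 y_sum0.
rewrite (weighted_sum_last y_sum0).
pose e i j := f 1%g - f (tperm (inc i) (inc j)).
pose g i := f 1%g - f (tperm (inc i) ord_max).
(* Eliminating the last weight in both sums leaves f(i j) - f(i n) - f(n j) + f(1), which is
   [g i + g j - e i j]. *)
have -> : \sum_(i < m) y (widen_ord (leqnSn m) i) *
      (\sum_j y j * f (tperm (widen_ord (leqnSn m) i) j)
         - \sum_j y j * f (tperm ord_max j)) =
    \sum_i \sum_j (x i * x j * g i + x i * x j * g j - x i * x j * e i j).
  apply: eq_bigr => i _; rewrite !(weighted_sum_last y_sum0) -sumrB mulr_sumr.
  apply: eq_bigr => j _; rewrite -mulrBr !incE !y_inc /e /g (tpermC ord_max (inc j)).
  by rewrite tperm1; ring.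
have -> : \sum_i \sum_j (x i * x j * g i + x i * x j * g j - x i * x j * e i j) =
    ((\sum_i x i) * (\sum_i x i * g i)) *+ 2 - \sum_i \sum_j x i * x j * e i j.
  have mulr_sum2 h : (\sum_i x i) * (\sum_j x j * h j) =
      \sum_i \sum_j x i * x j * h j.
    rewrite mulr_suml; apply: eq_bigr => i _; rewrite mulr_sumr.
    by apply: eq_bigr => j _; rewrite mulrA.
  have mulr_sum2C h : (\sum_i x i) * (\sum_j x j * h j) =
      \sum_i \sum_j x i * x j * h i.
    rewrite mulr_sum2 exchange_big /=; apply: eq_bigr => i _.
    by apply: eq_bigr => j _; rewrite (mulrC (x j)).
  rewrite mulr2n {1}mulr_sum2C mulr_sum2 -big_split -sumrB /=.
  by apply: eq_bigr => i _; rewrite -big_split -sumrB.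
rewrite sum_symmetric_lt => [|i j|i]; last 2 first.
- by rewrite /e tpermC (mulrC (x i)).
- by rewrite /e tperm1 subrr mulr0.
by rewrite -mulrnBl pmulrn_lge0 // subr_ge0.
Qed.

Theorem theorem1p2 (R : realType) (n : nat) (hn : (2 <= n)%N)
    (x : 'I_n.-1 -> R) (hx : forall i, 0 <= x i) :
  @gring_psd R[i] _ [set: 'S_n]%G
    ((\sum_(i < n.-1) (x i)%:C) *:
       (\sum_(i < n.-1) (x i)%:C *:
          (1%:M - transp R[i] (init_pt i) (last_pt hn)))
     - \sum_(i < n.-1) \sum_(j < n.-1 | (i < j)%N)
         ((x i)%:C * (x j)%:C) *:
           (1%:M - transp R[i] (init_pt i) (init_pt j))).
Proof.
(* With [n] of the form [m.+1], the type ['I_n.-1] reduces to ['I_m]. *)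
case: n hn x hx => // m hn x hx.
have xC_ge0 i : 0 <= (x i)%:C by rewrite ler0c.
have xC_real i : (x i)%:C \is Num.real by rewrite ger0_real.
have sa1 a b : gring_selfadj (1%:M - transp R[i] a b : 'M_#|[set: 'S_m.+1]%G|).
  rewrite -(repr_mx1 (regular_repr R[i] [set: 'S_m.+1]%G)).
  by apply: gring_selfadjB; apply: gring_selfadj_inv; rewrite ?inE ?invg1 ?tpermV.
set A := (X in gring_psd X).
have saA : gring_selfadj A.
  apply: gring_selfadjB.
    apply: gring_selfadjZ; first by rewrite rpred_sum.
    by apply: gring_selfadj_sum => i; apply: gring_selfadjZ.
  apply: gring_selfadj_sum => i; apply: gring_selfadj_sum => j.
  by apply: gring_selfadjZ; rewrite ?rpredM.
case: (saA) => RA sA; split=> // d rG rG_unitary.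
split=> [|v]; first exact: gring_op_selfadj.
(* Evaluating at [v] turns the claim into a scalar inequality for a function of positive type. *)
pose f g := gring_form rG v (regular_repr R[i] [set: 'S_m.+1]%G g).
have form_transp a b :
    gring_form rG v (1%:M - transp R[i] a b) = f 1%g - f (tperm a b).
  by rewrite gring_formB -(repr_mx1 (regular_repr R[i] [set: 'S_m.+1]%G)).
rewrite -[leRHS]/(gring_form rG v A) gring_formB gring_formZ !gring_form_sum.
under [X in _ * X - _]eq_bigr do rewrite gring_formZ form_transp.
under [X in _ - X]eq_bigr do
  (rewrite gring_form_sum; under eq_bigr do rewrite gring_formZ form_transp).
rewrite subr_ge0.
have -> : last_pt hn = ord_max by apply: val_inj.
exact: (octopus_pos_type (pos_type_unitary rG_unitary v) xC_ge0).
Qed.
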